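(* Let $\mathfrak C$ be a bicategory having all inverters and let $(\mathbf T,\Pi,\Psi,\beta,\eta,\pi,\mu)$ be a KZ-monad on $\mathfrak C$ such that $\mathbf T$ preserves pseudomonic 1-morphisms. Then the inclusion pseudofunctor into $\mathfrak C$ of the full sub-bicategory of $\mathfrak C$ made of the objects $C$ such that $(C,\Psi_C)$ is an inverter of $\mu_C$ has a left biadjoint.
   Context: Bicategories and pseudofunctors are in the general weak sense; $\circ$ is composition of 1-morphisms and vertical composition of 2-morphisms; $*$ is horizontal composition, a 1-morphism in a $*$-expression standing for its identity. Pseudonatural transformations are written $\Rightarrow$, modifications $\Rrightarrow$; $\Psi_{\mathbf T}$ has components $\Psi_{\mathbf T(X)}$ and $\mathbf T(\Psi)$ has components $\mathbf T(\Psi_X)$. For a pseudonatural $\Phi:\mathbf F\Rightarrow\mathbf G$ and a 1-morphism $f:X\to Y$, $\Phi_f:\mathbf G(f)\circ\Phi_X\Rightarrow\Phi_Y\circ\mathbf F(f)$ is the structural 2-isomorphism. Associators, unitors and constraint cells are suppressed below. **Pseudomonad** on $\mathfrak C$: a pseudofunctor $\mathbf T:\mathfrak C\to\mathfrak C$, pseudonatural transformations $\Pi:\mathbf T^2\Rightarrow\mathbf T$, $\Psi:\mathbf 1_{\mathfrak C}\Rightarrow\mathbf T$, and invertible modifications $\beta:\Pi\circ\Psi_{\mathbf T}\Rrightarrow1_{\mathbf T}$, $\eta:\Pi\circ\mathbf T(\Psi)\Rrightarrow1_{\mathbf T}$, $\pi:\Pi\circ\mathbf T(\Pi)\Rrightarrow\Pi\circ\Pi_{\mathbf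 T}$, satisfying the two usual coherence conditions (the pentagon-type condition for $\pi$ on $\mathbf T^4\Rightarrow\mathbf T$, and the unit condition that $\Pi*\mathbf T(\beta)$ equals $(\Pi*\eta_{\mathbf T})\circ(\pi*\mathbf T(\Psi_{\mathbf T}))$). **KZ-monad** $(\mathbf T,\Pi,\Psi,\beta,\eta,\pi,\mu)$: a pseudomonad with a modification $\mu:\Psi_{\mathbf T}\Rrightarrow\mathbf T(\Psi)$ satisfying, for every object $X$, the three coherence conditions: (i) $\mu_X*\Psi_X:\Psi_{\mathbf TX}\circ\Psi_X\Rightarrow\mathbf T(\Psi_X)\circ\Psi_X$ is the inverse of $\Psi_{\Psi_X}$; (ii) $\Pi_X*\mu_X=\eta_X^{-1}\circ\beta_X$; (iii) $(\Pi_X\circ\mathbf T(\Pi_X))*\mu_{\mathbf TX}$ is the canonical isomorphism $\Pi_X\circ\mathbf T(\Pi_X)\circ\Psi_{\mathbf T^2X}\cong\Pi_X\circ\Psi_{\mathbf TX}\circ\Pi_X\cong\Pi_X\cong\Pi_X\circ\mathbf T(\Pi_X)\circ\mathbf T(\Psi_{\mathbf TX})$ built from $\Psi_{\Pi_X}$, $\beta_X$ and $\mathbf T(\beta_X)^{-1}$. **Inverters.** For a 2-morphism $\phi:f_1\Rightarrow f_2$ between $f_1,f_2:X_1\to X_2$, an inverter cone is a pair $(X_0,f_0:X_0\to X_1)$ with $\phi*f_0$ invertible; for fixed $X_0$ these form a full subcategory $\mathbf{InvCone}(X_0;\phi)\subseteq\mathbf{Hom}(X_0,X_1)$. An inverter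 of $\phi$ is an inverter cone $(\tilde X_0,\tilde f_0)$ such that for every $X_0$, $\tilde f_0\circ-$ induces an equivalence $\mathbf{Hom}(X_0,\tilde X_0)\to\mathbf{InvCone}(X_0;\phi)$. $\mathfrak C$ has all inverters if every 2-morphism has one. A 1-morphism $f:X\to Y$ is pseudomonic if for every $W$ the functor $f\circ-:\mathbf{Hom}(W,X)\to\mathbf{Hom}(W,Y)$ is pseudomonic (faithful, and full on isomorphisms). A left biadjoint of $\mathbf R:\mathfrak B\to\mathfrak A$ is a pseudofunctor $\mathbf L:\mathfrak A\to\mathfrak B$ with pseudonatural $\mathrm H:\mathbf 1_{\mathfrak A}\Rightarrow\mathbf{RL}$, $\mathrm E:\mathbf{LR}\Rightarrow\mathbf 1_{\mathfrak B}$ and invertible modifications $\mathrm E_{\mathbf L}\circ\mathbf L(\mathrm H)\Rrightarrow1_{\mathbf L}$, $\mathbf R(\mathrm E)\circ\mathrm H_{\mathbf R}\Rrightarrow1_{\mathbf R}$. *)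

(* Defs.v *)
From Corelib Require Import ssreflect.

Set Implicit Arguments.
Unset Strict Implicit.
Unset Printing Implicit Defensive.

Declare Scope bicat_scope.
Delimit Scope bicat_scope with bicat.
Open Scope bicat_scope.

Reserved Notation "b • a" (at level 45, right associativity).
Reserved Notation "b ⋆ a" (at level 38, left associativity).
Reserved Notation "g ◁ a" (at level 38, left associativity).
Reserved Notation "a ▷ f" (at level 38, left associativity).
Reserved Notation "g ∘ f" (at level 35, right associativity).

Record category := Category {
  obj :> Type;
  mor : obj -> obj -> Type;
  idm : forall x, mor x x;
  cmp : forall x y z, mor y z -> mor x y -> mor x z;
  cmp_idl : forall x y (a : mor x y), cmp (idm y) a = a;
  cmp_idr : forall x y (a : mor x y), cmp a (idm x) = a;
  cmp_assoc : forall w x y z (c : mor y z) (b : mor x y) (a : mor w x),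
    cmp (cmp c b) a = cmp c (cmp b a)
}.

Arguments mor {_} _ _.
Arguments idm {_} _.
Arguments cmp {_ _ _ _} _ _.
Notation "b • a" := (cmp b a) : bicat_scope.

Record iso (C : category) (x y : C) := Iso {
  fwd :> mor x y;
  bwd : mor y x;
  bwd_fwd : bwd • fwd = idm x;
  fwd_bwd : fwd • bwd = idm y
}.

Arguments iso {C} x y.
Arguments Iso {C x y fwd bwd} _ _.

Definition is_iso (C : category) (x y : C) (a : mor x y) : Prop :=
  exists b : mor y x, b • a = idm x /\ a • b = idm y.

Definition iso_id (C : category) (x : C) : iso x x :=
  Iso (cmp_idl (idm x)) (cmp_idl (idm x)).

Definition iso_inv (C : category) (x y : C) (a : iso x y) : iso y x :=
  Iso (fwd_bwd a) (bwd_fwd a).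

Lemma cancel_mid (C : category) (x y z w : C) (d : mor y w) (c : mor z y)
  (b : mor y z) (a : mor x y) : c • b = idm y -> (d • c) • (b • a) = d • a.
Proof. by move=> h; rewrite cmp_assoc -(cmp_assoc c) h cmp_idl. Qed.

Definition iso_cmp (C : category) (x y z : C) (b : iso y z) (a : iso x y) :
  iso x z.
Proof.
exists (b • a) (bwd a • bwd b).
- by rewrite (cancel_mid _ _ (bwd_fwd b)) bwd_fwd.
- by rewrite (cancel_mid _ _ (fwd_bwd a)) fwd_bwd.
Defined.

Record functor (C D : category) := Functor {
  fun_obj :> C -> D;
  fun_mor : forall x y, mor x y -> mor (fun_obj x) (fun_obj y);
  fun_id : forall x, fun_mor (idm x) = idm (fun_obj x);
  fun_cmp : forall x y z (b : mor y z) (a : mor x y),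
    fun_mor (b • a) = fun_mor b • fun_mor a
}.

Arguments fun_mor {C D} F {x y} _ : rename.

Definition functor_id (C : category) : functor C C :=
  @Functor C C (fun x => x) (fun x y a => a)
    (fun x => eq_refl) (fun x y z b a => eq_refl).

Definition functor_cmp (C D E : category) (G : functor D E) (F : functor C D) :
  functor C E.
Proof.
exists (fun x => G (F x)) (fun x y a => fun_mor G (fun_mor F a)).
- by move=> x; rewrite !fun_id.
- by move=> x y z b a; rewrite !fun_cmp.
Defined.

Record nat_iso (C D : category) (F G : functor C D) := NatIso {
  ni_comp :> forall x, iso (F x) (G x);
  ni_nat : forall x y (a : mor x y),
    ni_comp y • fun_mor F a = fun_mor G a • ni_comp x
}.

Definition is_equivalence (C D : category) (F : functor C D) : Prop :=
  exists G : functor D C,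
    inhabited (nat_iso (functor_cmp G F) (functor_id C)) /\
    inhabited (nat_iso (functor_cmp F G) (functor_id D)).

Definition faithful (C D : category) (F : functor C D) : Prop :=
  forall (x y : C) (a b : mor x y), fun_mor F a = fun_mor F b -> a = b.

Definition full_on_isos (C D : category) (F : functor C D) : Prop :=
  forall (x y : C) (b : mor (F x) (F y)), is_iso b ->
    exists a : mor x y, is_iso a /\ fun_mor F a = b.

Definition pseudomonic_functor (C D : category) (F : functor C D) : Prop :=
  faithful F /\ full_on_isos F.

Definition full_subcategory (C : category) (P : C -> Prop) : category :=
  @Category {x : C | P x}
    (fun x y => mor (proj1_sig x) (proj1_sig y))
    (fun x => idm (proj1_sig x))
    (fun x y z b a => b • a)
    (fun x y a => cmp_idl a)
    (fun x y a => cmp_idr a)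
    (fun w x y z c b a => cmp_assoc c b a).

Record bicategory := Bicategory {
  ob :> Type;
  hom : ob -> ob -> category;
  id1 : forall X, hom X X;
  comp1 : forall X Y Z, hom Y Z -> hom X Y -> hom X Z;
  hcomp : forall X Y Z (g g' : hom Y Z) (f f' : hom X Y),
    mor g g' -> mor f f' -> mor (comp1 g f) (comp1 g' f');
  hcomp_id : forall X Y Z (g : hom Y Z) (f : hom X Y),
    hcomp (idm g) (idm f) = idm (comp1 g f);
  hcomp_cmp : forall X Y Z (g g' g'' : hom Y Z) (f f' f'' : hom X Y)
    (b' : mor g' g'') (b : mor g g') (a' : mor f' f'') (a : mor f f'),
    hcomp (b' • b) (a' • a) = hcomp b' a' • hcomp b a;
  assoc : forall W X Y Z (h : hom Y Z) (g : hom X Y) (f : hom W X),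
    iso (comp1 (comp1 h g) f) (comp1 h (comp1 g f));
  assoc_nat : forall W X Y Z (h h' : hom Y Z) (g g' : hom X Y) (f f' : hom W X)
    (c : mor h h') (b : mor g g') (a : mor f f'),
    assoc h' g' f' • hcomp (hcomp c b) a = hcomp c (hcomp b a) • assoc h g f;
  lunit : forall X Y (f : hom X Y), iso (comp1 (id1 Y) f) f;
  lunit_nat : forall X Y (f f' : hom X Y) (a : mor f f'),
    lunit f' • hcomp (idm (id1 Y)) a = a • lunit f;
  runit : forall X Y (f : hom X Y), iso (comp1 f (id1 X)) f;
  runit_nat : forall X Y (f f' : hom X Y) (a : mor f f'),
    runit f' • hcomp a (idm (id1 X)) = a • runit f;
  triangle : forall X Y Z (g : hom Y Z) (f : hom X Y),
    hcomp (idm g) (lunit f) • assoc g (id1 Y) f = hcomp (runit g) (idm f);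
  pentagon : forall V W X Y Z
    (k : hom Y Z) (h : hom X Y) (g : hom W X) (f : hom V W),
    hcomp (idm k) (assoc h g f) • assoc k (comp1 h g) f
      • hcomp (assoc k h g) (idm f)
    = assoc k h (comp1 g f) • assoc (comp1 k h) g f
}.

Arguments hom {_} _ _.
Arguments id1 {_} _.
Arguments comp1 {_ _ _ _} _ _.
Arguments hcomp {_ _ _ _ _ _ _ _} _ _.
Arguments assoc {_ _ _ _ _} h g f.
Arguments lunit {_ _ _} f.
Arguments runit {_ _ _} f.

Notation "g ∘ f" := (comp1 g f) : bicat_scope.
Notation "b ⋆ a" := (hcomp b a) : bicat_scope.
Notation "g ◁ a" := (hcomp (idm g) a) : bicat_scope.
Notation "a ▷ f" := (hcomp a (idm f)) : bicat_scope.

Lemma lwhisker_cmp (C : bicategory) (X Y Z : C) (g : hom Y Z)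
  (f f' f'' : hom X Y) (b : mor f' f'') (a : mor f f') :
  g ◁ (b • a) = (g ◁ b) • (g ◁ a).
Proof. by rewrite -hcomp_cmp cmp_idl. Qed.

Lemma rwhisker_cmp (C : bicategory) (X Y Z : C) (g g' g'' : hom Y Z)
  (f : hom X Y) (b : mor g' g'') (a : mor g g') :
  (b • a) ▷ f = (b ▷ f) • (a ▷ f).
Proof. by rewrite -hcomp_cmp cmp_idl. Qed.

Definition hcomp_iso (C : bicategory) (X Y Z : C) (g g' : hom Y Z)
  (f f' : hom X Y) (b : iso g g') (a : iso f f') : iso (g ∘ f) (g' ∘ f').
Proof.
exists (b ⋆ a) (bwd b ⋆ bwd a).
- by rewrite -hcomp_cmp !bwd_fwd hcomp_id.
- by rewrite -hcomp_cmp !fwd_bwd hcomp_id.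
Defined.

Definition lwhisker_iso (C : bicategory) (X Y Z : C) (g : hom Y Z)
  (f f' : hom X Y) (a : iso f f') : iso (g ∘ f) (g ∘ f') :=
  hcomp_iso (iso_id g) a.

Definition rwhisker_iso (C : bicategory) (X Y Z : C) (g g' : hom Y Z)
  (b : iso g g') (f : hom X Y) : iso (g ∘ f) (g' ∘ f) :=
  hcomp_iso b (iso_id f).

Definition postcomp (C : bicategory) (W X Y : C) (f : hom X Y) :
  functor (hom W X) (hom W Y).
Proof.
exists (fun g => f ∘ g) (fun g g' a => f ◁ a).
- by move=> g; rewrite hcomp_id.
- by move=> g g' g'' b a; apply: lwhisker_cmp.
Defined.

Definition pseudomonic (C : bicategory) (X Y : C) (f : hom X Y) : Prop :=
  forall W : C, pseudomonic_functor (postcomp W f).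

Definition is_inv_cone (C : bicategory) (X1 X2 : C) (f1 f2 : hom X1 X2)
  (phi : mor f1 f2) (X0 : C) (f0 : hom X0 X1) : Prop :=
  is_iso (phi ▷ f0).

Definition InvCone (C : bicategory) (X0 X1 X2 : C) (f1 f2 : hom X1 X2)
  (phi : mor f1 f2) : category :=
  full_subcategory (@is_inv_cone C X1 X2 f1 f2 phi X0).

Lemma is_inv_cone_precomp (C : bicategory) (X1 X2 : C) (f1 f2 : hom X1 X2)
  (phi : mor f1 f2) (X0 X : C) (f0 : hom X0 X1) (h : hom X X0) :
  is_inv_cone phi f0 -> is_inv_cone phi (f0 ∘ h).
Proof.
case=> psi [psiK Kpsi].
have nat g g' (c : mor g g') :
    c ▷ (f0 ∘ h) = assoc g' f0 h • (c ▷ f0 ▷ h) • bwd (assoc g f0 h).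
  by rewrite -cmp_assoc assoc_nat hcomp_id cmp_assoc fwd_bwd cmp_idr.
exists (assoc f1 f0 h • (psi ▷ h) • bwd (assoc f2 f0 h)); rewrite nat; split.
- rewrite -!cmp_assoc; do 3 rewrite ?cmp_assoc; rewrite -(cmp_assoc (bwd _)).
  by rewrite bwd_fwd cmp_idl -(cmp_assoc (psi ▷ h)) -hcomp_cmp psiK cmp_idl
    hcomp_id cmp_idl fwd_bwd.
- rewrite -!cmp_assoc; do 3 rewrite ?cmp_assoc; rewrite -(cmp_assoc (bwd _)).
  by rewrite bwd_fwd cmp_idl -(cmp_assoc (phi ▷ f0 ▷ h)) -hcomp_cmp Kpsi
    cmp_idl hcomp_id cmp_idl fwd_bwd.
Qed.

Definition inv_cone_functor (C : bicategory) (X1 X2 : C) (f1 f2 : hom X1 X2)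
  (phi : mor f1 f2) (X0 : C) (f0 : hom X0 X1) (cone : is_inv_cone phi f0)
  (X : C) : functor (hom X X0) (InvCone X phi) :=
  @Functor (hom X X0) (InvCone X phi)
    (fun h => exist _ (f0 ∘ h) (is_inv_cone_precomp h cone))
    (fun h h' a => f0 ◁ a)
    (fun h => hcomp_id f0 h)
    (fun h h' h'' b a => fun_cmp (postcomp X f0) b a).

Definition is_inverter (C : bicategory) (X1 X2 : C) (f1 f2 : hom X1 X2)
  (phi : mor f1 f2) (X0 : C) (f0 : hom X0 X1) : Prop :=
  exists cone : is_inv_cone phi f0,
    forall X : C, is_equivalence (inv_cone_functor cone X).

Definition has_inverters (C : bicategory) : Prop :=
  forall (X1 X2 : C) (f1 f2 : hom X1 X2) (phi : mor f1 f2),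
    exists (X0 : C) (f0 : hom X0 X1), is_inverter phi f0.

(* The action on objects and 1-morphisms only.  With primitive projections,
   composition of these is strictly associative and unital up to conversion,
   whereas that of pseudofunctors is so only up to propositional equality of
   the compositors.  Components and structural cells of transformations are
   typed over this layer, so that e.g. (T T) T and T (T T) need no cast. *)
Set Primitive Projections.
Record prefunctor (B C : bicategory) := Prefunctor {
  pre_ob :> B -> C;
  pre_map1 : forall X Y, hom X Y -> hom (pre_ob X) (pre_ob Y)
}.
Unset Primitive Projections.

Arguments pre_map1 {B C} F {X Y} f : rename.
Notation map1 F f := (pre_map1 F f).

Definition prefunctor_id (C : bicategory) : prefunctor C C :=
  @Prefunctor C C (fun X => X) (fun X Y f => f).

Definition prefunctor_cmp (B C D : bicategory) (G : prefunctor C D)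
  (F : prefunctor B C) : prefunctor B D :=
  @Prefunctor B D (fun X => G (F X)) (fun X Y f => map1 G (map1 F f)).

Record pseudofunctor (B C : bicategory) := Pseudofunctor {
  pf_pre :> prefunctor B C;
  map2 : forall (X Y : B) (f f' : hom X Y),
    mor f f' -> mor (map1 pf_pre f) (map1 pf_pre f');
  map2_id : forall (X Y : B) (f : hom X Y), map2 (idm f) = idm (map1 pf_pre f);
  map2_cmp : forall (X Y : B) (f f' f'' : hom X Y)
    (b : mor f' f'') (a : mor f f'), map2 (b • a) = map2 b • map2 a;
  pf_comp : forall (X Y Z : B) (g : hom Y Z) (f : hom X Y),
    iso (map1 pf_pre g ∘ map1 pf_pre f) (map1 pf_pre (g ∘ f));
  pf_comp_nat : forall (X Y Z : B) (g g' : hom Y Z) (f f' : hom X Y)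
    (b : mor g g') (a : mor f f'),
    pf_comp g' f' • (map2 b ⋆ map2 a) = map2 (b ⋆ a) • pf_comp g f;
  pf_unit : forall X : B, iso (id1 (pf_pre X)) (map1 pf_pre (id1 X));
  pf_assoc : forall (W X Y Z : B) (h : hom Y Z) (g : hom X Y) (f : hom W X),
    map2 (assoc h g f) • pf_comp (h ∘ g) f • (pf_comp h g ▷ map1 pf_pre f)
    = pf_comp h (g ∘ f) • (map1 pf_pre h ◁ pf_comp g f)
      • assoc (map1 pf_pre h) (map1 pf_pre g) (map1 pf_pre f);
  pf_lunit : forall (X Y : B) (f : hom X Y),
    map2 (lunit f) • pf_comp (id1 Y) f • (pf_unit Y ▷ map1 pf_pre f)
    = lunit (map1 pf_pre f);
  pf_runit : forall (X Y : B) (f : hom X Y),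
    map2 (runit f) • pf_comp f (id1 X) • (map1 pf_pre f ◁ pf_unit X)
    = runit (map1 pf_pre f)
}.

Arguments map2 {B C} F {X Y f f'} _ : rename.
Arguments pf_comp {B C} F {X Y Z} g f : rename.
Arguments pf_unit {B C} F X : rename.

Definition map2_iso (B C : bicategory) (F : pseudofunctor B C) (X Y : B)
  (f f' : hom X Y) (a : iso f f') : iso (map1 F f) (map1 F f').
Proof.
exists (map2 F a) (map2 F (bwd a)).
- by rewrite -map2_cmp bwd_fwd map2_id.
- by rewrite -map2_cmp fwd_bwd map2_id.
Defined.

Definition pseudofunctor_id (C : bicategory) : pseudofunctor C C.
Proof.
refine (@Pseudofunctor C C (prefunctor_id C) (fun X Y f f' a => a)
  (fun X Y f => eq_refl) (fun X Y f f' f'' b a => eq_refl)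
  (fun X Y Z g f => iso_id (g ∘ f)) _ (fun X => iso_id (id1 X)) _ _ _) => /=.
- by move=> *; rewrite cmp_idl cmp_idr.
- by move=> *; rewrite !hcomp_id !cmp_idl !cmp_idr.
- by move=> *; rewrite hcomp_id !cmp_idr.
- by move=> *; rewrite hcomp_id !cmp_idr.
Defined.

Definition pseudofunctor_cmp (B C D : bicategory) (G : pseudofunctor C D)
  (F : pseudofunctor B C) : pseudofunctor B D.
Proof.
refine (@Pseudofunctor B D (prefunctor_cmp G F)
  (fun X Y f f' a => map2 G (map2 F a)) _ _
  (fun X Y Z g f => iso_cmp (map2_iso G (pf_comp F g f))
                      (pf_comp G (map1 F g) (map1 F f))) _
  (fun X => iso_cmp (map2_iso G (pf_unit F X)) (pf_unit G (F X))) _ _ _) => /=.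
- by move=> X Y f; rewrite !map2_id.
- by move=> X Y f f' f'' b a; rewrite !map2_cmp.
- move=> X Y Z g g' f f' b a.
  by rewrite cmp_assoc pf_comp_nat -!cmp_assoc -!map2_cmp pf_comp_nat.
- move=> W X Y Z h g f.
  have wr (a := pf_comp F h g) :
      pf_comp G (map1 F (h ∘ g)) (map1 F f) • (map2 G a ▷ map1 G (map1 F f))
      = map2 G (a ▷ map1 F f) • pf_comp G (map1 F h ∘ map1 F g) (map1 F f).
    by rewrite -(map2_id G (map1 F f)) pf_comp_nat.
  have wl (a := pf_comp F g f) :
      pf_comp G (map1 F h) (map1 F (g ∘ f)) • (map1 G (map1 F h) ◁ map2 G a)
      = map2 G (map1 F h ◁ a) • pf_comp G (map1 F h) (map1 F g ∘ map1 F f).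
    by rewrite -(map2_id G (map1 F h)) pf_comp_nat.
  rewrite rwhisker_cmp lwhisker_cmp.
  rewrite !cmp_assoc -(cmp_assoc (pf_comp G _ _) (_ ▷ _)) wr.
  rewrite -(cmp_assoc (pf_comp G _ _) (_ ◁ map2 _ _)) wl.
  by rewrite !cmp_assoc -pf_assoc -!cmp_assoc -!map2_cmp !cmp_assoc pf_assoc.
- move=> X Y f.
  have wr (a := pf_unit F Y) :
      pf_comp G (map1 F (id1 Y)) (map1 F f) • (map2 G a ▷ map1 G (map1 F f))
      = map2 G (a ▷ map1 F f) • pf_comp G (id1 (F Y)) (map1 F f).
    by rewrite -(map2_id G (map1 F f)) pf_comp_nat.
  rewrite rwhisker_cmp.
  rewrite !cmp_assoc -(cmp_assoc (pf_comp G _ _) (_ ▷ _)) wr.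
  by rewrite !cmp_assoc -[RHS]pf_lunit -!cmp_assoc -!map2_cmp !cmp_assoc
    pf_lunit.
- move=> X Y f.
  have wl (a := pf_unit F X) :
      pf_comp G (map1 F f) (map1 F (id1 X)) • (map1 G (map1 F f) ◁ map2 G a)
      = map2 G (map1 F f ◁ a) • pf_comp G (map1 F f) (id1 (F X)).
    by rewrite -(map2_id G (map1 F f)) pf_comp_nat.
  rewrite lwhisker_cmp.
  rewrite !cmp_assoc -(cmp_assoc (pf_comp G _ _) (_ ◁ map2 _ _)) wl.
  by rewrite !cmp_assoc -[RHS]pf_runit -!cmp_assoc -!map2_cmp !cmp_assoc
    pf_runit.
Defined.

Definition preserves_pseudomonic (B C : bicategory) (F : pseudofunctor B C) :
  Prop :=
  forall (X Y : B) (f : hom X Y), pseudomonic f -> pseudomonic (map1 F f).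

(* The data of a pseudonatural transformation.  Modifications are defined over
   this data, since their naturality condition does not involve the axioms; all
   those considered below are between composites of pseudonatural
   transformations. *)
Record trans (B C : bicategory) (F G : prefunctor B C) := Trans {
  tr_ob :> forall X : B, hom (F X) (G X);
  tr_cell : forall (X Y : B) (f : hom X Y),
    iso (map1 G f ∘ tr_ob X) (tr_ob Y ∘ map1 F f)
}.

Arguments tr_cell {B C F G} Phi {X Y} f : rename.

Record pseudonat (B C : bicategory) (F G : pseudofunctor B C) := Pseudonat {
  pn_trans :> trans F G;
  pn_nat : forall (X Y : B) (f f' : hom X Y) (a : mor f f'),
    (pn_trans Y ◁ map2 F a) • tr_cell pn_trans f
    = tr_cell pn_trans f' • (map2 G a ▷ pn_trans X);
  pn_comp : forall (X Y Z : B) (g : hom Y Z) (f : hom X Y),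
    tr_cell pn_trans (g ∘ f) • (pf_comp G g f ▷ pn_trans X)
    = (pn_trans Z ◁ pf_comp F g f)
      • assoc (pn_trans Z) (map1 F g) (map1 F f)
      • (tr_cell pn_trans g ▷ map1 F f)
      • bwd (assoc (map1 G g) (pn_trans Y) (map1 F f))
      • (map1 G g ◁ tr_cell pn_trans f)
      • assoc (map1 G g) (map1 G f) (pn_trans X);
  pn_unit : forall X : B,
    tr_cell pn_trans (id1 X) • (pf_unit G X ▷ pn_trans X)
    = (pn_trans X ◁ pf_unit F X) • bwd (runit (pn_trans X))
      • lunit (pn_trans X)
}.

Definition trans_id (B C : bicategory) (F : prefunctor B C) : trans F F :=
  @Trans B C F F (fun X => id1 (F X))
    (fun X Y f => iso_cmp (iso_inv (lunit (map1 F f))) (runit (map1 F f))).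

Definition trans_cmp (B C : bicategory) (F G H : prefunctor B C)
  (Theta : trans G H) (Phi : trans F G) : trans F H :=
  @Trans B C F H (fun X => Theta X ∘ Phi X)
    (fun X Y f =>
      iso_cmp (iso_inv (assoc (Theta Y) (Phi Y) (map1 F f)))
      (iso_cmp (lwhisker_iso (Theta Y) (tr_cell Phi f))
      (iso_cmp (assoc (Theta Y) (map1 G f) (Phi X))
      (iso_cmp (rwhisker_iso (tr_cell Theta f) (Phi X))
               (iso_inv (assoc (map1 H f) (Theta X) (Phi X))))))).

(* Phi_F *)
Definition trans_pre (A B C : bicategory) (G H : prefunctor B C)
  (Phi : trans G H) (F : prefunctor A B) :
  trans (prefunctor_cmp G F) (prefunctor_cmp H F) :=
  @Trans A C (prefunctor_cmp G F) (prefunctor_cmp H F)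
    (fun X => Phi (F X)) (fun X Y f => tr_cell Phi (map1 F f)).

(* K(Phi) *)
Definition trans_post (B C D : bicategory) (K : pseudofunctor C D)
  (F G : prefunctor B C) (Phi : trans F G) :
  trans (prefunctor_cmp K F) (prefunctor_cmp K G) :=
  @Trans B D (prefunctor_cmp K F) (prefunctor_cmp K G)
    (fun X => map1 K (Phi X))
    (fun X Y f =>
      iso_cmp (iso_inv (pf_comp K (Phi Y) (map1 F f)))
      (iso_cmp (map2_iso K (tr_cell Phi f))
               (pf_comp K (map1 G f) (Phi X)))).

Record modification (B C : bicategory) (F G : prefunctor B C)
  (Phi Phi' : trans F G) := Modification {
  md_comp :> forall X : B, mor (Phi X) (Phi' X);
  md_nat : forall (X Y : B) (f : hom X Y),
    (md_comp Y ▷ map1 F f) • tr_cell Phi f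
    = tr_cell Phi' f • (map1 G f ◁ md_comp X)
}.

Record inv_modification (B C : bicategory) (F G : prefunctor B C)
  (Phi Phi' : trans F G) := InvModification {
  im_comp :> forall X : B, iso (Phi X) (Phi' X);
  im_nat : forall (X Y : B) (f : hom X Y),
    (im_comp Y ▷ map1 F f) • tr_cell Phi f
    = tr_cell Phi' f • (map1 G f ◁ im_comp X)
}.

(* F(a) for a 2-morphism a between composites, read as a 2-morphism between
   composites of images. *)
Definition map2_comp (B C : bicategory) (F : pseudofunctor B C) (X Y Y' Z : B)
  (g : hom Y Z) (f : hom X Y) (g' : hom Y' Z) (f' : hom X Y')
  (a : mor (g ∘ f) (g' ∘ f')) :
  mor (map1 F g ∘ map1 F f) (map1 F g' ∘ map1 F f') :=
  bwd (pf_comp F g' f') • map2 F a • pf_comp F g f.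

(* F(a) for a : g f => 1, read as a 2-morphism F(g) F(f) => 1. *)
Definition map2_comp_unit (B C : bicategory) (F : pseudofunctor B C) (X Y : B)
  (g : hom Y X) (f : hom X Y) (a : iso (g ∘ f) (id1 X)) :
  iso (map1 F g ∘ map1 F f) (id1 (F X)) :=
  iso_cmp (iso_inv (pf_unit F X)) (iso_cmp (map2_iso F a) (pf_comp F g f)).

(* In the coherence conditions below, composites of 1-morphisms are bracketed to
   the right, except in the third condition of a KZ-monad, where whiskering by
   m o T(m) forces (m o T(m)) o _. *)
Record pseudomonad (C : bicategory) := Pseudomonad {
  pm_fun :> pseudofunctor C C;
  pm_mult : pseudonat (pseudofunctor_cmp pm_fun pm_fun) pm_fun;
  pm_unit : pseudonat (pseudofunctor_id C) pm_fun;
  pm_beta : inv_modification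
    (trans_cmp pm_mult (trans_pre pm_unit pm_fun)) (trans_id pm_fun);
  pm_eta : inv_modification
    (trans_cmp pm_mult (trans_post pm_fun pm_unit)) (trans_id pm_fun);
  pm_pi : inv_modification
    (trans_cmp pm_mult (trans_post pm_fun pm_mult))
    (trans_cmp pm_mult (trans_pre pm_mult pm_fun));
  pm_pentagon : forall (X : C) (T := pm_fun) (m := pm_mult) (p := pm_pi),
    (m X ◁ p (T X))
      • assoc (m X) (m (T X)) (map1 T (m (T X)))
      • (p X ▷ map1 T (m (T X)))
      • bwd (assoc (m X) (map1 T (m X)) (map1 T (m (T X))))
      • (m X ◁ map2_comp T (p X))
    = assoc (m X) (m (T X)) (m (T (T X)))
      • (p X ▷ m (T (T X)))
      • bwd (assoc (m X) (map1 T (m X)) (m (T (T X))))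
      • (m X ◁ bwd (tr_cell m (m X)))
      • assoc (m X) (m (T X)) (map1 T (map1 T (m X)))
      • (p X ▷ map1 T (map1 T (m X)))
      • bwd (assoc (m X) (map1 T (m X)) (map1 T (map1 T (m X))));
  pm_unit_coh : forall (X : C)
    (T := pm_fun) (m := pm_mult) (u := pm_unit) (p := pm_pi),
    m X ◁ map2_comp_unit T (pm_beta X)
    = (m X ◁ pm_eta (T X))
      • assoc (m X) (m (T X)) (map1 T (u (T X)))
      • (p X ▷ map1 T (u (T X)))
      • bwd (assoc (m X) (map1 T (m X)) (map1 T (u (T X))))
}.

Record KZ_monad (C : bicategory) := KZMonad {
  kz_monad :> pseudomonad C;
  kz_mu : modification
    (trans_pre (pm_unit kz_monad) kz_monad)
    (trans_post kz_monad (pm_unit kz_monad));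
  kz_coh1 : forall (X : C) (T := kz_monad) (u := pm_unit T),
    kz_mu X ▷ u X = bwd (tr_cell u (u X));
  kz_coh2 : forall (X : C) (T := kz_monad) (m := pm_mult T),
    m X ◁ kz_mu X = bwd (pm_eta T X) • pm_beta T X;
  kz_coh3 : forall (X : C) (T := kz_monad) (m := pm_mult T) (u := pm_unit T),
    (m X ∘ map1 T (m X)) ◁ kz_mu (T X)
    = bwd (assoc (m X) (map1 T (m X)) (map1 T (u (T X))))
      • (m X ◁ bwd (map2_comp_unit T (pm_beta T X)))
      • bwd (runit (m X))
      • lunit (m X)
      • (pm_beta T X ▷ m X)
      • bwd (assoc (m X) (u (T X)) (m X))
      • (m X ◁ tr_cell u (m X))
      • assoc (m X) (map1 T (m X)) (u (T (T X)))
}.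

Definition full_subbicategory (C : bicategory) (P : C -> Prop) : bicategory :=
  @Bicategory {X : C | P X}
    (fun X Y => hom (proj1_sig X) (proj1_sig Y))
    (fun X => id1 (proj1_sig X))
    (fun X Y Z g f => g ∘ f)
    (fun X Y Z g g' f f' b a => b ⋆ a)
    (fun X Y Z g f => hcomp_id g f)
    (fun X Y Z g g' g'' f f' f'' b' b a' a => hcomp_cmp b' b a' a)
    (fun W X Y Z h g f => assoc h g f)
    (fun W X Y Z h h' g g' f f' c b a => assoc_nat c b a)
    (fun X Y f => lunit f)
    (fun X Y f f' a => lunit_nat a)
    (fun X Y f => runit f)
    (fun X Y f f' a => runit_nat a)
    (fun X Y Z g f => triangle g f)
    (fun V W X Y Z k h g f => pentagon k h g f).

Definition inclusion (C : bicategory) (P : C -> Prop) :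
  pseudofunctor (full_subbicategory P) C.
Proof.
refine (@Pseudofunctor (full_subbicategory P) C
  (@Prefunctor (full_subbicategory P) C
     (fun X => proj1_sig X) (fun X Y f => f))
  (fun X Y f f' a => a)
  (fun X Y f => eq_refl) (fun X Y f f' f'' b a => eq_refl)
  (fun X Y Z g f => iso_id _) _ (fun X => iso_id _) _ _ _) => /=.
- by move=> *; rewrite cmp_idl cmp_idr.
- by move=> *; rewrite !hcomp_id !cmp_idl !cmp_idr.
- by move=> *; rewrite hcomp_id !cmp_idr.
- by move=> *; rewrite hcomp_id !cmp_idr.
Defined.

Record left_biadjoint (A B : bicategory) (R : pseudofunctor B A) :=
  LeftBiadjoint {
  lb_fun :> pseudofunctor A B;
  lb_unit : pseudonat (pseudofunctor_id A) (pseudofunctor_cmp R lb_fun);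
  lb_counit : pseudonat (pseudofunctor_cmp lb_fun R) (pseudofunctor_id B);
  lb_left : inv_modification
    (trans_cmp (trans_pre lb_counit lb_fun) (trans_post lb_fun lb_unit))
    (trans_id lb_fun);
  lb_right : inv_modification
    (trans_cmp (trans_post R lb_counit) (trans_pre lb_unit R))
    (trans_id R)
}.

Definition has_left_biadjoint (A B : bicategory) (R : pseudofunctor B A) :
  Prop := inhabited (left_biadjoint R).

(* Main.v *)
(* For an object X let j : X' -> T X be an inverter of mu_X.  By (i), Psi_X is an
   inverter cone, so Psi_X = j n up to isomorphism for some n : X -> X'.  This n
   is a reflection of X.

   The 2-morphism Pi_TX * T(mu_X) : 1 => T(Psi_X) Pi_X becomes invertible along
   T(j).  Since T(j) is pseudomonic, it follows that T(n) and Pi_X T(j) are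
   inverse equivalences, and that T(n) j = Psi_X'.  The equivalence T X' = T X
   carries Psi_X' to j and mu_X' to mu_X, hence (X', Psi_X') is an inverter of
   mu_X'.  If (Y, Psi_Y) is an inverter of mu_Y and f : X -> Y, then T(f) j is a
   cone for mu_Y; the factorization of T(f) j through Psi_Y is the extension of f
   along n. *)
From Corelib Require Import ssreflect.
From Stdlib Require Import IndefiniteDescription.
Require Import Defs.

Set Implicit Arguments.
Unset Strict Implicit.
Unset Printing Implicit Defensive.

(** * Coherence in a bicategory *)

Section Category.
Context (C : category).
Implicit Types w x y z : C.

Lemma bwdK w x y (a : iso x y) (c : mor w x) : bwd a • (a • c) = c.
Proof. by rewrite -cmp_assoc bwd_fwd cmp_idl. Qed.

Lemma fwdK w x y (a : iso x y) (c : mor w y) : a • (bwd a • c) = c.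
Proof. by rewrite -cmp_assoc fwd_bwd cmp_idl. Qed.

Lemma iso_monic w x y (a : iso x y) (b c : mor w x) : a • b = a • c -> b = c.
Proof. by move=> e; rewrite -(bwdK a b) e bwdK. Qed.

Lemma iso_epic x y z (a : iso x y) (b c : mor y z) : b • a = c • a -> b = c.
Proof.
by move=> e; rewrite -(cmp_idr b) -(fwd_bwd a) -cmp_assoc e cmp_assoc fwd_bwd
  cmp_idr.
Qed.

Lemma bwd_nat w x y z (a : iso w x) (b : iso y z) (c : mor x z) (d : mor w y) :
  b • d = c • a -> d • bwd a = bwd b • c.
Proof.
by move=> e; apply: (iso_monic (a := b)); rewrite fwdK -cmp_assoc e cmp_assoc
  fwd_bwd cmp_idr.
Qed.

(** The free tail [e] lets an equation between composites be rewritten in the middle of a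
    right-nested composite. *)
Lemma cmp_congr w x y y' z (a : mor x y) (b : mor y z) (c : mor x y')
  (d : mor y' z) : b • a = d • c ->
  forall e : mor w x, b • (a • e) = d • (c • e).
Proof. by move=> h e; rewrite -!cmp_assoc h. Qed.

Lemma cmp_congr1 w x y z (a : mor x y) (b : mor y z) (c : mor x z) :
  b • a = c -> forall e : mor w x, b • (a • e) = c • e.
Proof. by move=> h e; rewrite -!cmp_assoc h. Qed.

Lemma is_iso_fwd x y (a : iso x y) : is_iso a.
Proof. by exists (bwd a); rewrite bwd_fwd fwd_bwd. Qed.

Lemma is_isoP x y (a : mor x y) : is_iso a -> exists b : iso x y, fwd b = a.
Proof. by case=> b [h k]; exists (Iso h k). Qed.

Lemma is_iso_cmp x y z (b : mor y z) (a : mor x y) :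
  is_iso b -> is_iso a -> is_iso (b • a).
Proof.
by move=> /is_isoP[b' <-] /is_isoP[a' <-]; apply: (is_iso_fwd (iso_cmp b' a')).
Qed.

Lemma is_iso_conj x x' y y' (i : iso x x') (j : iso y y') (a : mor x y)
  (b : mor x' y') : j • a = b • i -> is_iso a <-> is_iso b.
Proof.
move=> e; split=> h.
- have -> : b = j • a • bwd i by rewrite -cmp_assoc e cmp_assoc fwd_bwd cmp_idr.
  apply: is_iso_cmp (is_iso_fwd j) _.
  exact: is_iso_cmp h (is_iso_fwd (iso_inv i)).
- have -> : a = bwd j • b • i by rewrite -e bwdK.
  apply: is_iso_cmp (is_iso_fwd (iso_inv j)) _.
  exact: is_iso_cmp h (is_iso_fwd i).
Qed.

End Category.

Lemma fun_is_iso (C D : category) (F : functor C D) (x y : C) (a : mor x y) :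
  is_iso a -> is_iso (fun_mor F a).
Proof. by case=> b [h k]; exists (fun_mor F b); rewrite -!fun_cmp h k !fun_id. Qed.

Section Bicategory.
Context (C : bicategory).
Implicit Types W X Y Z : C.

Lemma interchange X Y Z (g g' : hom Y Z) (f f' : hom X Y) (b : mor g g')
  (a : mor f f') : (b ▷ f') • (g ◁ a) = (g' ◁ a) • (b ▷ f).
Proof. by rewrite -!hcomp_cmp !cmp_idl !cmp_idr. Qed.

Lemma assoc_natl W X Y Z (h h' : hom Y Z) (g : hom X Y) (f : hom W X)
  (c : mor h h') :
  (c ▷ (g ∘ f)) • assoc h g f = assoc h' g f • (c ▷ g ▷ f).
Proof. by rewrite assoc_nat hcomp_id. Qed.

Lemma assoc_natm W X Y Z (h : hom Y Z) (g g' : hom X Y) (f : hom W X)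
  (b : mor g g') :
  (h ◁ (b ▷ f)) • assoc h g f = assoc h g' f • ((h ◁ b) ▷ f).
Proof. by rewrite assoc_nat. Qed.

Lemma assoc_natr W X Y Z (h : hom Y Z) (g : hom X Y) (f f' : hom W X)
  (a : mor f f') :
  (h ◁ (g ◁ a)) • assoc h g f = assoc h g f' • ((h ∘ g) ◁ a).
Proof. by rewrite -hcomp_id assoc_nat. Qed.

Section Pentagon.
Context (V W X Y Z : C) (k : hom Y Z) (h : hom X Y) (g : hom W X) (f : hom V W).

Lemma pentagon_cmp (a : hom V Z) (c : mor a (((k ∘ h) ∘ g) ∘ f)) :
  (k ◁ assoc h g f) • assoc k (h ∘ g) f • (assoc k h g ▷ f) • c
  = assoc k h (g ∘ f) • assoc (k ∘ h) g f • c.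
Proof. by rewrite -[RHS]cmp_assoc -pentagon !cmp_assoc. Qed.

Lemma pentagon_bwd_left :
  (k ◁ bwd (assoc h g f)) • assoc k h (g ∘ f)
  = assoc k (h ∘ g) f • (assoc k h g ▷ f) • bwd (assoc (k ∘ h) g f).
Proof.
apply: (iso_monic (a := lwhisker_iso k (assoc h g f))) => /=.
by rewrite pentagon_cmp fwd_bwd cmp_idr -cmp_assoc -lwhisker_cmp fwd_bwd
  hcomp_id cmp_idl.
Qed.

Lemma pentagon_bwd_right (a : hom V Z) (c : mor a ((k ∘ h ∘ g) ∘ f)) :
  bwd (assoc k h (g ∘ f)) • (k ◁ assoc h g f) • assoc k (h ∘ g) f • c
  = assoc (k ∘ h) g f • (bwd (assoc k h g) ▷ f) • c.
Proof.
by rewrite -{1}(fwdK (rwhisker_iso (assoc k h g) f) c) /= pentagon_cmp bwdK.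
Qed.

End Pentagon.

Lemma lwhisker_id1_inj X Y (f f' : hom X Y) (a b : mor f f') :
  id1 Y ◁ a = id1 Y ◁ b -> a = b.
Proof. by move=> e; apply: (iso_epic (a := lunit f)); rewrite -!lunit_nat e. Qed.

Lemma rwhisker_id1_inj X Y (f f' : hom X Y) (a b : mor f f') :
  a ▷ id1 X = b ▷ id1 X -> a = b.
Proof. by move=> e; apply: (iso_epic (a := runit f)); rewrite -!runit_nat e. Qed.

(** Kelly's argument: whiskering with an identity 1-morphism is injective on 2-morphisms, and after
    whiskering the equation follows from the pentagon and two triangles. *)
Lemma lunit_comp1 X Y Z (g : hom Y Z) (f : hom X Y) :
  lunit (g ∘ f) • assoc (id1 Z) g f = lunit g ▷ f.
Proof.
apply: lwhisker_id1_inj; rewrite lwhisker_cmp.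
apply: (iso_epic (a := assoc (id1 Z) (id1 Z ∘ g) f)).
apply: (iso_epic (a := rwhisker_iso (assoc (id1 Z) (id1 Z) g) f)) => /=.
rewrite assoc_natm !cmp_assoc -rwhisker_cmp triangle pentagon.
by rewrite -(cmp_assoc (_ ◁ _)) triangle assoc_natl.
Qed.

Lemma runit_comp1 X Y Z (g : hom Y Z) (f : hom X Y) :
  (g ◁ runit f) • assoc g f (id1 X) = runit (g ∘ f).
Proof.
apply: rwhisker_id1_inj.
apply: (iso_monic (a := assoc g f (id1 X))); rewrite rwhisker_cmp.
rewrite -cmp_assoc -assoc_natm -[in RHS]triangle -(cmp_assoc (fwd _) (_ ◁ _)).
by rewrite -assoc_natr -triangle lwhisker_cmp !cmp_assoc pentagon.
Qed.

Lemma lunit_id1 X : lunit (id1 X) = runit (id1 X) :> mor _ _.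
Proof.
apply: rwhisker_id1_inj; rewrite -triangle -lunit_comp1; congr (_ • _).
by apply: (iso_monic (a := lunit (id1 X))); rewrite lunit_nat.
Qed.

End Bicategory.

(** * Squares *)

(* A square over [f] is a 1-cell [f] in the domain together with a 1-cell
   between the codomains of [p] and [q]; these are the 1-cells of the
   bicategory of arrows of [C]. *)
Section Squares.
Context (C : bicategory).

Record square (X X' Y Y' : C) (p : hom X X') (q : hom Y Y') (f : hom X Y) :=
  Square {
  sq_top :> hom X' Y';
  sq_cell : iso (sq_top ∘ p) (q ∘ f)
}.

(** The pairs [(a, b)] satisfying this are the 2-cells of the bicategory of arrows. The lemmas below
    close them under all bicategorical operations. *)
Definition over (X X' Y Y' : C) (p : hom X X') (q : hom Y Y') (f f' : hom X Y)
  (S : square p q f) (S' : square p q f') (a : mor f f') (b : mor S S') : Prop :=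
  sq_cell S' • (b ▷ p) = (q ◁ a) • sq_cell S.

Arguments over {X X' Y Y' p q f f'} S S' a b.

Definition sq_id1 (X X' : C) (p : hom X X') : square p p (id1 X) :=
  @Square _ _ _ _ p p (id1 X) (id1 X') (iso_cmp (iso_inv (runit p)) (lunit p)).

Definition sq_comp1 (X X' Y Y' Z Z' : C) (p : hom X X') (q : hom Y Y')
  (r : hom Z Z') (g : hom Y Z) (f : hom X Y) (S : square q r g)
  (S' : square p q f) : square p r (g ∘ f) :=
  @Square _ _ _ _ p r (g ∘ f) (S ∘ S')
    (iso_cmp (assoc r g f)
    (iso_cmp (rwhisker_iso (sq_cell S) f)
    (iso_cmp (iso_inv (assoc S q f))
    (iso_cmp (lwhisker_iso S (sq_cell S'))
             (assoc S S' p))))).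

Section Cells.
Context (X X' Y Y' : C) (p : hom X X') (q : hom Y Y').

Lemma over_idm (f : hom X Y) (S : square p q f) : over S S (idm f) (idm S).
Proof. by rewrite /over !hcomp_id cmp_idl cmp_idr. Qed.

Lemma over_cmp (f f' f'' : hom X Y) (S : square p q f) (S' : square p q f')
  (S'' : square p q f'') (a' : mor f' f'') (a : mor f f') b' b :
  over S' S'' a' b' -> over S S' a b -> over S S'' (a' • a) (b' • b).
Proof.
rewrite /over => h' h.
by rewrite rwhisker_cmp -cmp_assoc h' cmp_assoc h -cmp_assoc -lwhisker_cmp.
Qed.

Lemma over_bwd (f f' : hom X Y) (S : square p q f) (S' : square p q f')
  (a : iso f f') (b : iso S S') : over S S' a b -> over S' S (bwd a) (bwd b).
Proof.
rewrite /over => h.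
apply: (iso_epic (a := rwhisker_iso b p)) => /=.
rewrite !cmp_assoc h -rwhisker_cmp bwd_fwd hcomp_id cmp_idr.
by rewrite -cmp_assoc -lwhisker_cmp bwd_fwd hcomp_id cmp_idl.
Qed.

Lemma over_lunit (f : hom X Y) (S : square p q f) :
  over (sq_comp1 (sq_id1 q) S) S (lunit f) (lunit S).
Proof.
rewrite /over /= rwhisker_cmp !cmp_assoc -(cmp_assoc (q ◁ _)) triangle.
rewrite -(cmp_assoc (_ ▷ _)) -rwhisker_cmp fwd_bwd hcomp_id cmp_idl.
rewrite -(lunit_comp1 q f) cmp_assoc fwdK (cmp_congr (lunit_nat _)).
by rewrite lunit_comp1.
Qed.

Lemma over_runit (f : hom X Y) (S : square p q f) :
  over (sq_comp1 S (sq_id1 p)) S (runit f) (runit S).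
Proof.
rewrite /over /= lwhisker_cmp !cmp_assoc triangle.
rewrite (cmp_congr1 (runit_comp1 _ _)) (cmp_congr (runit_nat _)).
congr (_ • _); rewrite -runit_comp1 !cmp_assoc fwdK -cmp_assoc -lwhisker_cmp.
by rewrite fwd_bwd hcomp_id cmp_idl.
Qed.

End Cells.

Lemma over_hcomp (X X' Y Y' Z Z' : C) (p : hom X X') (q : hom Y Y')
  (r : hom Z Z') (g g' : hom Y Z) (f f' : hom X Y) (S : square q r g)
  (S' : square q r g') (R : square p q f) (R' : square p q f') (b : mor g g')
  (a : mor f f') (b' : mor S S') (a' : mor R R') :
  over S S' b b' -> over R R' a a' ->
  over (sq_comp1 S R) (sq_comp1 S' R') (b ⋆ a) (b' ⋆ a').
Proof.
rewrite /over /= => hb ha; rewrite !cmp_assoc assoc_nat.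
have -> : (S' ◁ sq_cell R') • (b' ⋆ (a' ▷ p)) • assoc S R p
    = (b' ⋆ (q ◁ a)) • (S ◁ sq_cell R) • assoc S R p.
  by rewrite -!cmp_assoc -!hcomp_cmp ha cmp_idl cmp_idr.
rewrite -(cmp_congr (bwd_nat (assoc_nat b' (idm q) a))) -(cmp_assoc (_ ▷ f')).
rewrite -hcomp_cmp hb cmp_idl -{1}(cmp_idr a) hcomp_cmp cmp_assoc.
by rewrite (cmp_congr (assoc_nat _ _ _)).
Qed.

Lemma over_assoc (X X' Y Y' Z Z' W W' : C) (p : hom X X') (q : hom Y Y')
  (r : hom Z Z') (s : hom W W') (h : hom Z W) (g : hom Y Z) (f : hom X Y)
  (S3 : square r s h) (S2 : square q r g) (S1 : square p q f) :
  over (sq_comp1 (sq_comp1 S3 S2) S1) (sq_comp1 S3 (sq_comp1 S2 S1))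
    (assoc h g f) (assoc S3 S2 S1).
Proof.
rewrite /over /= !lwhisker_cmp !rwhisker_cmp !cmp_assoc pentagon.
rewrite (cmp_congr (assoc_natr _ _ _)).
rewrite pentagon_cmp -(cmp_congr (assoc_natl _ _ _)); do 2 congr (_ • _).
rewrite (cmp_congr (pentagon_bwd_left _ _ _ _)) !cmp_assoc.
rewrite (cmp_congr (assoc_natm _ _ _)).
by rewrite pentagon_bwd_right.
Qed.
End Squares.

Arguments over {C X X' Y Y' p q f f'} S S' a b.
Arguments sq_id1 {C X X'} p.

(** * Squares with identity 1-morphisms as sides *)

Section IdentityCell.
Context (C : bicategory).

(** This is the structural cell of the identity transformation; the next three lemmas are its
    pseudonaturality axioms. *)
Definition id_cell (X Y : C) (f : hom X Y) : iso (f ∘ id1 X) (id1 Y ∘ f) :=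
  iso_cmp (iso_inv (lunit f)) (runit f).

Lemma id_cell_nat (X Y : C) (f f' : hom X Y) (a : mor f f') :
  id_cell f' • (a ▷ id1 X) = (id1 Y ◁ a) • id_cell f.
Proof.
apply: (iso_monic (a := lunit f')) => /=.
by rewrite cmp_assoc fwdK runit_nat (cmp_congr (lunit_nat _)) fwdK.
Qed.

Lemma id_cell_id1 (X : C) :
  id_cell (id1 X) = bwd (runit (id1 X)) • lunit (id1 X) :> mor _ _.
Proof. by rewrite /= -lunit_id1 bwd_fwd lunit_id1 bwd_fwd. Qed.

Lemma id_cell_comp1 (X Y Z : C) (g : hom Y Z) (f : hom X Y) :
  id_cell (g ∘ f) = assoc (id1 Z) g f • (id_cell g ▷ f)
    • bwd (assoc g (id1 Y) f) • (g ◁ id_cell f) • assoc g f (id1 X) :> mor _ _.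
Proof.
apply: (iso_monic (a := lunit (g ∘ f))) => /=.
rewrite fwdK (cmp_congr1 (lunit_comp1 _ _)) rwhisker_cmp !cmp_assoc.
rewrite -(cmp_assoc (lunit g ▷ f)) -rwhisker_cmp fwd_bwd hcomp_id cmp_idl.
rewrite -triangle cmp_assoc fwdK -cmp_assoc -lwhisker_cmp fwdK.
by rewrite runit_comp1.
Qed.

Lemma id_cell_cmp (X Y X' Y' : C) (p : hom X X') (q : hom Y Y') (h : hom X' Y')
  (f : hom X Y) (t : mor (h ∘ p) (q ∘ f)) :
  (lunit q ▷ f) • bwd (assoc (id1 Y') q f) • (id1 Y' ◁ t)
    • assoc (id1 Y') h p • (id_cell h ▷ p) • bwd (assoc h (id1 X') p)
  = t • (h ◁ lunit p).
Proof.
rewrite -(lunit_comp1 q f) cmp_assoc fwdK (cmp_congr (lunit_nat _)).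
rewrite (cmp_congr1 (lunit_comp1 _ _)) -(cmp_assoc (lunit h ▷ p)).
by rewrite -rwhisker_cmp /= fwdK -triangle cmp_assoc fwd_bwd cmp_idr.
Qed.

Definition sq_of (X Y : C) (f : hom X Y) : square (id1 X) (id1 Y) f :=
  Square (id_cell f).

(** A 1-morphism [p] viewed as a square from [p] to an identity. Taken at [n X], it is the target of
    the first triangle modification. *)
Definition sq_unit (X X' : C) (p : hom X X') : square p (id1 X') p :=
  Square (iso_id (id1 X' ∘ p)).

Lemma over_sq_of (X Y : C) (f f' : hom X Y) (a : mor f f') :
  over (sq_of f) (sq_of f') a a.
Proof. exact: id_cell_nat. Qed.

Lemma over_sq_of_id1 (X : C) :
  over (sq_id1 (id1 X)) (sq_of (id1 X)) (idm (id1 X)) (idm (id1 X)).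
Proof. by rewrite /over !hcomp_id cmp_idl cmp_idr id_cell_id1. Qed.

Lemma over_sq_of_comp1 (X Y Z : C) (g : hom Y Z) (f : hom X Y) :
  over (sq_comp1 (sq_of g) (sq_of f)) (sq_of (g ∘ f)) (idm (g ∘ f))
    (idm (g ∘ f)).
Proof. by rewrite /over !hcomp_id cmp_idl cmp_idr id_cell_comp1. Qed.

Lemma over_sq_unit (X X' Y Y' : C) (p : hom X X') (q : hom Y Y') (f : hom X Y)
  (S : square p q f) :
  over (sq_comp1 (sq_of S) (sq_unit p)) (sq_comp1 (sq_unit q) S) (sq_cell S)
    (id_cell S).
Proof.
rewrite /over /= !hcomp_id !cmp_idl bwd_fwd cmp_idr fwdK.
by rewrite cmp_assoc.
Qed.

(** With [R] and [R'] the counit squares, [S] the reflection of [f] and [b] the counit cell, the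
    conclusion is the naturality of the second triangle modification. *)
Lemma over_id_cell (X X' Y Y' : C) (p : hom X X') (q : hom Y Y') (f : hom X Y)
  (S : square p q f) (R : square p (id1 X) (id1 X))
  (R' : square q (id1 Y) (id1 Y)) (b : mor (f ∘ R) (R' ∘ S)) :
  over (sq_comp1 (sq_of f) R) (sq_comp1 R' S) (id_cell f) b ->
  ((lunit (id1 Y) • sq_cell R') ▷ f) • bwd (assoc R' q f) • (R' ◁ sq_cell S)
    • assoc R' S p • (b ▷ p) • bwd (assoc f R p)
  = id_cell f • (f ◁ (lunit (id1 X) • sq_cell R)).
Proof.
rewrite /over [sq_cell _]/= [sq_cell (sq_comp1 (sq_of f) R)]/= => h.
apply: (iso_epic (a := assoc f R p)).
rewrite rwhisker_cmp lwhisker_cmp !cmp_assoc bwd_fwd cmp_idr.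
have {}h : (sq_cell R' ▷ f) • bwd (assoc R' q f) • (R' ◁ sq_cell S)
    • assoc R' S p • (b ▷ p)
  = bwd (assoc (id1 Y) (id1 Y) f) • (id1 Y ◁ id_cell f)
    • assoc (id1 Y) f (id1 X) • (id_cell f ▷ id1 X)
    • bwd (assoc f (id1 X) (id1 X)) • (f ◁ sq_cell R) • assoc f R p.
  apply: (iso_monic (a := assoc (id1 Y) (id1 Y) f)).
  by rewrite fwdK -h /= !cmp_assoc.
rewrite h -!cmp_assoc; do 2 congr (_ • _).
by rewrite !cmp_assoc id_cell_cmp /= cmp_assoc.
Qed.

End IdentityCell.

(** * A biadjoint from pointwise reflections *)

(* A 2-cell between squares out of [n X] is determined by the 2-cell it lies
   over, so each axiom below reduces to an identity between the 2-cells of [C]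
   underneath. *)
Section Biadjoint.
Context (C : bicategory) (P : C -> Prop).
Context (refl : C -> C) (reflP : forall X, P (refl X)).
Context (n : forall X, hom X (refl X)).
(** [ext], [lift] with [lift_over], and [over_inj] express in terms of squares that precomposition
    with [n X] is essentially surjective, full and faithful on 1-morphisms into objects of [P]. *)
Context (ext : forall (X Y Z : C) (q : hom Y Z) (f : hom X Y),
  P Z -> square (n X) q f).
Context (lift : forall (X Y Z : C) (q : hom Y Z) (f f' : hom X Y)
  (S : square (n X) q f) (S' : square (n X) q f'),
  P Z -> mor f f' -> mor S S').
Context (lift_over : forall (X Y Z : C) (q : hom Y Z) (f f' : hom X Y)
  (S : square (n X) q f) (S' : square (n X) q f') (PZ : P Z) (a : mor f f'),
  over S S' a (lift S S' PZ a)).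
Context (over_inj : forall (X Y Z : C) (q : hom Y Z) (f f' : hom X Y)
  (S : square (n X) q f) (S' : square (n X) q f') (a : mor f f')
  (b b' : mor S S'), P Z -> over S S' a b -> over S S' a b' -> b = b').

Let over_eq (X Y Z : C) (q : hom Y Z) (PZ : P Z) (f f' : hom X Y)
  (S : square (n X) q f) (S' : square (n X) q f') (a a' : mor f f')
  (b b' : mor S S') : over S S' a b -> over S S' a' b' -> a = a' -> b = b'.
Proof. by move=> h h' e; apply: over_inj h _ => //; rewrite e. Qed.

Definition lift_iso (X Y Z : C) (q : hom Y Z) (f f' : hom X Y)
  (S : square (n X) q f) (S' : square (n X) q f') (PZ : P Z) (a : iso f f') :
  iso S S'.
Proof.
exists (lift S S' PZ a) (lift S' S PZ (bwd a)).
- exact (over_eq PZ (over_cmp (lift_over S' S PZ _) (lift_over _ _ _ _))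
    (over_idm S) (bwd_fwd a)).
- exact (over_eq PZ (over_cmp (lift_over S S' PZ _) (lift_over _ _ _ _))
    (over_idm S') (fwd_bwd a)).
Defined.

Lemma lift_iso_over (X Y Z : C) (q : hom Y Z) (f f' : hom X Y)
  (S : square (n X) q f) (S' : square (n X) q f') (PZ : P Z) (a : iso f f') :
  over S S' a (lift_iso S S' PZ a).
Proof. exact: lift_over. Qed.

Notation B := (full_subbicategory P).

Definition refl_sub (X : C) : B := exist _ (refl X) (reflP X).

Definition refl_sq (X Y : C) (f : hom X Y) : square (n X) (n Y) f :=
  ext (n Y) f (reflP Y).

Definition reflector_pre : prefunctor C B :=
  @Prefunctor C B refl_sub (fun X Y f => sq_top (refl_sq f)).

Definition reflector : pseudofunctor C B.
Proof.
refine (@Pseudofunctor C B reflector_pre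
  (fun X Y f f' a => lift (refl_sq f) (refl_sq f') (reflP Y) a) _ _
  (fun X Y Z g f => lift_iso (sq_comp1 (refl_sq g) (refl_sq f))
     (refl_sq (g ∘ f)) (reflP Z) (iso_id (g ∘ f))) _
  (fun X => lift_iso (sq_id1 (n X)) (refl_sq (id1 X)) (reflP X)
     (iso_id (id1 X))) _ _ _).
- move=> X Y f.
  exact (over_inj (reflP Y) (lift_over _ _ _ _) (over_idm _)).
- move=> X Y f f' f'' b a.
  exact (over_inj (reflP Y) (lift_over _ _ _ _)
    (over_cmp (lift_over _ _ _ _) (lift_over _ _ _ _))).
- move=> X Y Z g g' f f' b a.
  refine (over_eq (reflP Z)
    (over_cmp (lift_iso_over _ _ _ _)
      (over_hcomp (lift_over _ _ _ _) (lift_over _ _ _ _)))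
    (over_cmp (lift_over _ _ _ _) (lift_iso_over _ _ _ _)) _).
  by rewrite cmp_idl cmp_idr.
- move=> W X Y Z h g f.
  refine (over_eq (reflP Z)
    (over_cmp (lift_over _ _ _ _) (over_cmp (lift_iso_over _ _ _ _)
      (over_hcomp (lift_iso_over _ _ _ _) (over_idm _))))
    (over_cmp (lift_iso_over _ _ _ _) (over_cmp
      (over_hcomp (over_idm _) (lift_iso_over _ _ _ _)) (over_assoc _ _ _))) _).
  by rewrite !hcomp_id !cmp_idl !cmp_idr.
- move=> X Y f.
  refine (over_eq (reflP Y)
    (over_cmp (lift_over _ _ _ _) (over_cmp (lift_iso_over _ _ _ _)
      (over_hcomp (lift_iso_over _ _ _ _) (over_idm _))))
    (over_lunit _) _).
  by rewrite !hcomp_id !cmp_idr.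
- move=> X Y f.
  refine (over_eq (reflP Y)
    (over_cmp (lift_over _ _ _ _) (over_cmp (lift_iso_over _ _ _ _)
      (over_hcomp (over_idm _) (lift_iso_over _ _ _ _))))
    (over_runit _) _).
  by rewrite !hcomp_id !cmp_idr.
Defined.

(** The structural cells are those of the squares [refl_sq f]. Naturality is then [lift_over]
    itself, and the two other axioms say that the compositors and unitors of [reflector] lie over
    identities. *)
Definition reflector_unit :
  pseudonat (pseudofunctor_id C) (pseudofunctor_cmp (inclusion P) reflector).
Proof.
exists (@Trans C C (pseudofunctor_id C)
  (pseudofunctor_cmp (inclusion P) reflector) n
  (fun X Y f => sq_cell (refl_sq f))).
- by move=> X Y f f' a; rewrite [RHS]lift_over.
- move=> X Y Z g f /=; rewrite cmp_idr.
  refine (eq_trans (lift_over (sq_comp1 _ _) (refl_sq (g ∘ f)) _ _) _).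
  by rewrite /= hcomp_id cmp_idl.
- move=> X /=; rewrite cmp_idr.
  refine (eq_trans (lift_over (sq_id1 _) (refl_sq (id1 X)) _ _) _).
  by rewrite /= hcomp_id cmp_idl.
Defined.

(** The extension of the identity of [X] along its own reflection: its top is the counit component,
    its cell the isomorphism used for the second triangle. *)
Definition counit_sq (X : B) :
  square (n (proj1_sig X)) (id1 (proj1_sig X)) (id1 (proj1_sig X)) :=
  ext (id1 _) (id1 _) (proj2_sig X).

Definition counit_cell (X Y : B) (f : hom (proj1_sig X) (proj1_sig Y)) :
  iso (f ∘ sq_top (counit_sq X)) (sq_top (counit_sq Y) ∘ refl_sq f) :=
  lift_iso (sq_comp1 (sq_of f) (counit_sq X))
    (sq_comp1 (counit_sq Y) (refl_sq f)) (proj2_sig Y) (id_cell f).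

Lemma counit_cell_over (X Y : B) (f : hom (proj1_sig X) (proj1_sig Y)) :
  over (sq_comp1 (sq_of f) (counit_sq X))
    (sq_comp1 (counit_sq Y) (refl_sq f)) (id_cell f) (counit_cell f).
Proof. exact: lift_over. Qed.

Definition reflector_counit :
  pseudonat (pseudofunctor_cmp reflector (inclusion P)) (pseudofunctor_id B).
Proof.
exists (@Trans B B (pseudofunctor_cmp reflector (inclusion P))
  (pseudofunctor_id B) (fun X => sq_top (counit_sq X)) counit_cell).
- move=> X Y f f' a.
  refine (over_eq (proj2_sig Y)
    (over_cmp (over_hcomp (over_idm _) (lift_over _ _ _ _))
      (counit_cell_over f))
    (over_cmp (counit_cell_over f')
      (over_hcomp (over_sq_of _) (over_idm _))) _).
  by rewrite id_cell_nat.
- move=> X Y Z g f.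
  refine (over_eq (proj2_sig Z)
    (over_cmp (counit_cell_over (g ∘ f))
      (over_hcomp (over_sq_of_comp1 _ _) (over_idm _)))
    (over_cmp (over_hcomp (over_idm _)
        (* The compositor of [reflector] after the inclusion has as a factor the image of an
           identity 2-morphism, hence the lift of [idm]. *)
        (over_cmp (lift_over (refl_sq (g ∘ f)) (refl_sq (g ∘ f)) _ (idm _))
          (lift_iso_over _ _ _ _)))
    (over_cmp (over_assoc _ _ _)
    (over_cmp (over_hcomp (counit_cell_over _) (over_idm _))
    (over_cmp (over_bwd (over_assoc _ _ _))
    (over_cmp (over_hcomp (over_idm _) (counit_cell_over _))
       (over_assoc _ _ _)))))) _).
  by rewrite (id_cell_comp1 (C := C)) cmp_idl !hcomp_id cmp_idl cmp_idr.
- move=> X.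
  refine (over_eq (proj2_sig X)
    (over_cmp (counit_cell_over (id1 X))
      (over_hcomp (over_sq_of_id1 _) (over_idm _)))
    (over_cmp (over_hcomp (over_idm _)
        (over_cmp (lift_over _ _ _ (idm _)) (lift_iso_over _ _ _ _)))
      (over_cmp (over_bwd (over_runit _)) (over_lunit _))) _).
  by rewrite cmp_idl !hcomp_id cmp_idl cmp_idr (id_cell_id1 (C := C)).
Defined.

(** The component at [X] is the lift of [lunit (n X)]; its naturality reduces to [id_cell_cmp]
    underneath. *)
Definition reflector_left : inv_modification
  (trans_cmp (trans_pre reflector_counit reflector)
     (trans_post reflector reflector_unit)) (trans_id reflector).
Proof.
exists (fun X => lift_iso (sq_comp1 (counit_sq (refl_sub X)) (refl_sq (n X)))
  (sq_unit (n X)) (reflP X) (lunit (n X))) => X Y f.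
refine (over_eq (reflP Y)
  (over_cmp (over_hcomp (lift_iso_over _ _ _ _) (over_idm _))
  (over_cmp (over_bwd (over_assoc _ _ _))
  (over_cmp (over_hcomp (over_idm _)
     (over_cmp (over_bwd (lift_iso_over _ _ _ _))
     (over_cmp (lift_over _ _ _ (sq_cell (refl_sq f)))
       (lift_iso_over _ _ _ _))))
  (over_cmp (over_assoc _ _ _)
  (over_cmp (over_hcomp
     (counit_cell_over (X := refl_sub X) (Y := refl_sub Y) (refl_sq f))
     (over_idm (refl_sq (n X))))
    (over_bwd (over_assoc _ _ _)))))))
  (over_cmp (over_sq_unit (refl_sq f))
    (over_hcomp (over_idm _) (lift_iso_over _ _ _ _))) _).
by rewrite /= cmp_idl cmp_idr (id_cell_cmp (C := C)).
Qed.

Definition reflector_right : inv_modification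
  (trans_cmp (trans_post (inclusion P) reflector_counit)
     (trans_pre reflector_unit (inclusion P))) (trans_id (inclusion P)).
Proof.
exists (fun X => iso_cmp (lunit (id1 (proj1_sig X))) (sq_cell (counit_sq X)))
  => X Y f /=.
by rewrite cmp_idl cmp_idr; exact: (over_id_cell (counit_cell_over f)).
Qed.
End Biadjoint.

(** * Equivalences of categories *)

(** [is_iso] is a proposition, so an inverse has to be chosen before it can serve as data. *)
Definition is_iso_iso (C : category) (x y : C) (a : mor x y) (h : is_iso a) :
  iso x y :=
  let (b, hb) := constructive_indefinite_description _ h in
  Iso (proj1 hb) (proj2 hb).

Section Equivalence.
Context (C D : category) (F : functor C D) (eF : is_equivalence F).

Lemma equivalence_faithful : faithful F.
Proof.
case: eF => G [[u] _] x y a b e.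
by apply: (iso_epic (a := u x)); rewrite -!(ni_nat u) /= e.
Qed.

Lemma equivalence_full (x y : C) (b : mor (F x) (F y)) :
  exists a : mor x y, fun_mor F a = b.
Proof.
case: eF => G [[u] [v]].
exists (u y • fun_mor G b • bwd (u x)).
(* Since [F G] is isomorphic to the identity, [G] is faithful, and images under [G] may be compared
   instead. *)
have G_inj (c : mor (F x) (F y)) : fun_mor G c = fun_mor G b -> c = b.
  by move=> e; apply: (iso_epic (a := v (F x))); rewrite -!(ni_nat v) /= e.
apply: G_inj; apply: (iso_monic (a := u y)); rewrite (ni_nat u) /=.
by rewrite !cmp_assoc bwd_fwd cmp_idr.
Qed.

Lemma equivalence_surj (y : D) : exists x : C, inhabited (iso (F x) y).
Proof. by case: eF => G [_ [v]]; exists (G y); constructor; exact: (v y). Qed.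

Lemma equivalence_pseudomonic : pseudomonic_functor F.
Proof.
split; first exact: equivalence_faithful.
move=> x y b [c [cb bc]].
have [a ea] := equivalence_full b; have [a' ea'] := equivalence_full c.
exists a; split=> //; exists a'.
by split; apply: equivalence_faithful; rewrite fun_cmp ea ea' fun_id.
Qed.

End Equivalence.

Section NatIso.
Context (A B : category).

Definition nat_iso_id (F : functor A B) : nat_iso F F.
Proof. by exists (fun x => iso_id (F x)) => x y a; rewrite cmp_idl cmp_idr. Defined.

Definition nat_iso_cmp (F G H : functor A B) (t : nat_iso G H)
  (s : nat_iso F G) : nat_iso F H.
Proof.
exists (fun x => iso_cmp (t x) (s x)) => x y a /=.
by rewrite cmp_assoc (ni_nat s) -cmp_assoc (ni_nat t) cmp_assoc.
Defined.

Definition fun_iso (F : functor A B) (x y : A) (a : iso x y) : iso (F x) (F y).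
Proof.
exists (fun_mor F a) (fun_mor F (bwd a)); rewrite -fun_cmp.
- by rewrite bwd_fwd fun_id.
- by rewrite fwd_bwd fun_id.
Defined.

End NatIso.

Definition nat_iso_post (A B C : category) (H : functor B C)
  (F G : functor A B) (t : nat_iso F G) :
  nat_iso (functor_cmp H F) (functor_cmp H G).
Proof.
exists (fun x => fun_iso H (t x)) => x y a /=.
by rewrite -!fun_cmp (ni_nat t).
Defined.

Definition nat_iso_assoc (A B C D : category) (H : functor C D)
  (G : functor B C) (F : functor A B) :
  nat_iso (functor_cmp (functor_cmp H G) F) (functor_cmp H (functor_cmp G F)).
Proof.
by exists (fun x => iso_id (H (G (F x)))) => x y a; rewrite cmp_idl cmp_idr.
Defined.

(** If [V] and [W] are quasi-inverse to [J] and [M], then [V G] is quasi-inverse to [F]: on one side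
    [V G F ≅ V J ≅ 1]; on the other [G F V G ≅ J V G ≅ G], where the outer [G] is cancelled by
    [W H G ≅ 1]. *)
Lemma two_of_six (A B C D : category) (F : functor A B) (G : functor B C)
  (H : functor C D) (J : functor A C) (M : functor B D) :
  nat_iso (functor_cmp G F) J -> nat_iso (functor_cmp H G) M ->
  is_equivalence J -> is_equivalence M -> is_equivalence F.
Proof.
move=> s t [V [[VJ] [JV]]] [W [[WM] _]].
exists (functor_cmp V G); split; constructor.
  exact (nat_iso_cmp VJ (nat_iso_cmp (nat_iso_post V s) (nat_iso_assoc _ _ _))).
have WHG : nat_iso (functor_cmp W (functor_cmp H G)) (functor_id B).
  exact: nat_iso_cmp WM (nat_iso_post W t).
exists (fun y => iso_cmp (WHG y) (iso_cmp (fun_iso W (fun_iso H (JV (G y))))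
  (iso_cmp (fun_iso W (fun_iso H (s (V (G y))))) (iso_inv (WHG (F (V (G y)))))))).
move=> y y' b /=; rewrite !cmp_assoc.
rewrite -(bwd_nat (ni_nat WHG (fun_mor F (fun_mor V (fun_mor G b))))) /=.
have /= es := ni_nat (nat_iso_post W (nat_iso_post H s))
  (fun_mor V (fun_mor G b)).
have /= eJ := ni_nat (nat_iso_post W (nat_iso_post H JV)) (fun_mor G b).
by rewrite (cmp_congr es) (cmp_congr eJ) (cmp_congr (ni_nat WHG b)).
Qed.

(** * Pseudomonic 1-morphisms, inverters and invertibility of whiskered 2-morphisms *)

Section Pseudomonic.
Context (C : bicategory).

Definition precomp (W X Y : C) (f : hom W X) : functor (hom X Y) (hom W Y).
Proof.
exists (fun g => g ∘ f) (fun g g' a => a ▷ f).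
- by move=> g; rewrite hcomp_id.
- by move=> g g' g'' b a; apply: rwhisker_cmp.
Defined.

Lemma pseudomonic_reflect_iso (W X Y : C) (f : hom X Y) (g h : hom W X) :
  pseudomonic f -> iso (f ∘ g) (f ∘ h) -> inhabited (iso g h).
Proof.
move=> /(_ W)[_ fullf] i.
by have [a [/is_isoP[b _] _]] := fullf g h i (is_iso_fwd i); constructor.
Qed.

(** Composition with [f0] is an equivalence onto the cones followed by the inclusion of a full
    subcategory, and both are pseudomonic. *)
Lemma inverter_pseudomonic (X1 X2 X0 : C) (f1 f2 : hom X1 X2)
  (phi : mor f1 f2) (f0 : hom X0 X1) : is_inverter phi f0 -> pseudomonic f0.
Proof.
move=> [cone eJ] W; have [faithJ fullJ] := equivalence_pseudomonic (eJ W).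
by split=> [x y a b e | x y b isob]; [apply: faithJ e | apply: fullJ isob].
Qed.

Lemma inverter_factor (X1 X2 X0 W : C) (f1 f2 : hom X1 X2)
  (phi : mor f1 f2) (f0 : hom X0 X1) (g : hom W X1) :
  is_inverter phi f0 -> is_inv_cone phi g ->
  exists h : hom W X0, inhabited (iso (f0 ∘ h) g).
Proof.
move=> [cone eJ] coneg.
have [h [i]] := equivalence_surj (eJ W) (exist _ g coneg).
exists h; constructor.
exact (@Iso _ (f0 ∘ h) g (fwd i) (bwd i) (bwd_fwd i) (fwd_bwd i)).
Qed.

Lemma is_iso_rwhisker_iso (W X Y : C) (g g' : hom X Y) (f f' : hom W X)
  (b : mor g g') : iso f f' -> is_iso (b ▷ f) <-> is_iso (b ▷ f').
Proof.
move=> i; apply: (is_iso_conj (i := lwhisker_iso g i) (j := lwhisker_iso g' i)).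
by rewrite /= interchange.
Qed.

Lemma is_iso_rwhisker_comp1 (V W X Y : C) (g g' : hom X Y) (f : hom W X)
  (h : hom V W) (b : mor g g') :
  is_iso (b ▷ f ▷ h) <-> is_iso (b ▷ (f ∘ h)).
Proof.
apply: (is_iso_conj (i := assoc g f h) (j := assoc g' f h)).
by rewrite assoc_natl.
Qed.

Lemma is_iso_lwhisker_rwhisker (W X Y Z : C) (h : hom Y Z) (g g' : hom X Y)
  (f : hom W X) (b : mor g g') :
  is_iso ((h ◁ b) ▷ f) <-> is_iso (h ◁ (b ▷ f)).
Proof.
apply: (is_iso_conj (i := assoc h g f) (j := assoc h g' f)).
by rewrite assoc_natm.
Qed.

(** Whiskering [h ◁ b] further with [k] gives a conjugate of [b]. *)
Lemma lwhisker_reflect_iso (W X Y : C) (k : hom Y X) (h : hom X Y)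
  (g g' : hom W X) (b : mor g g') :
  iso (k ∘ h) (id1 X) -> is_iso (h ◁ b) -> is_iso b.
Proof.
move=> i /(fun_is_iso (postcomp W k)) /= isob.
apply/(is_iso_conj (eq_sym (bwd_nat (lunit_nat b))
  : iso_inv (lunit g') • b = _ • iso_inv (lunit g))).
apply/(is_iso_conj (interchange (bwd i) b
  : rwhisker_iso (iso_inv i) g' • _ = _ • rwhisker_iso (iso_inv i) g)).
by apply/(is_iso_conj (eq_sym (assoc_natr k h b))).
Qed.

End Pseudomonic.

(** * The reflection of an object *)

Section Reflection.
Context (C : bicategory) (T : KZ_monad C).
Notation m := (pm_mult T).
Notation u := (pm_unit T).
Notation mu := (kz_mu T).

(** Naturality of the modification [mu] at [g] conjugates [mu Y ▷ T(g)] to [TT(g) ◁ mu X] by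
    invertible structural cells. In particular [T(g)] carries cones of [mu X] to cones of [mu Y]. *)
Lemma mu_nat_is_iso (X Y W : C) (g : hom X Y) (f : hom W (T X)) :
  is_iso (mu Y ▷ (map1 T g ∘ f)) <->
  is_iso (map1 T (map1 T g) ◁ (mu X ▷ f)).
Proof.
apply: iff_trans (is_iso_lwhisker_rwhisker _ _ _).
apply: iff_trans (iff_sym (is_iso_rwhisker_comp1 _ _ _)) _.
apply: iff_sym; apply: (is_iso_conj
  (i := rwhisker_iso (tr_cell (trans_pre u T) g) f)
  (j := rwhisker_iso (tr_cell (trans_post T u) g) f)).
by rewrite [fwd _]/= [in RHS]/= -!rwhisker_cmp (md_nat mu g).
Qed.

Lemma mu_cone_unit (X : C) : is_inv_cone (mu X) (u X).
Proof. by rewrite /is_inv_cone kz_coh1; exact: (is_iso_fwd (iso_inv _)). Qed.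

Definition cone_iso (W X Y : C) (f1 f2 : hom X Y) (phi : mor f1 f2)
  (x y : InvCone W phi) (i : iso (proj1_sig x) (proj1_sig y)) : iso x y :=
  @Iso (InvCone W phi) x y (fwd i) (bwd i) (bwd_fwd i) (fwd_bwd i).

Lemma assoc_whisker_nat (W X Y Z : C) (g : hom Y Z) (f : hom X Y) (k : hom X Z)
  (i : mor (g ∘ f) k) (h h' : hom W X) (a : mor h h') :
  ((i ▷ h') • bwd (assoc g f h')) • (g ◁ (f ◁ a))
  = (k ◁ a) • (i ▷ h) • bwd (assoc g f h).
Proof.
rewrite cmp_assoc -(bwd_nat (eq_sym (assoc_natr g f a))).
by rewrite (cmp_congr (interchange i a)).
Qed.

Lemma assoc_whisker_unit_nat (W X Y : C) (g : hom Y X) (f : hom X Y)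
  (i : mor (g ∘ f) (id1 X)) (h h' : hom W X) (a : mor h h') :
  (lunit h' • (i ▷ h') • bwd (assoc g f h')) • (g ◁ (f ◁ a))
  = a • lunit h • (i ▷ h) • bwd (assoc g f h).
Proof.
by rewrite cmp_assoc assoc_whisker_nat (cmp_congr (lunit_nat a)).
Qed.

Definition adjust_cone (W X Y X1 X2 : C) (f1 f2 : hom X Y) (phi : mor f1 f2)
  (g1 g2 : hom X1 X2) (psi : mor g1 g2) (e : hom X X1)
  (h : forall f : hom W X, is_inv_cone phi f -> is_inv_cone psi (e ∘ f)) :
  functor (InvCone W phi) (InvCone W psi).
Proof.
exists (fun f => exist _ (e ∘ proj1_sig f) (h _ (proj2_sig f)))
  (fun f f' a => e ◁ a : mor (e ∘ proj1_sig f) (e ∘ proj1_sig f')).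
- by move=> f; rewrite hcomp_id.
- by move=> f f' f'' b a; apply: lwhisker_cmp.
Defined.

Definition restrict_cone (W W' X Y : C) (f1 f2 : hom X Y) (phi : mor f1 f2)
  (n : hom W W') : functor (InvCone W' phi) (InvCone W phi).
Proof.
exists (fun f => exist _ (proj1_sig f ∘ n) (is_inv_cone_precomp n (proj2_sig f)))
  (fun f f' a => a ▷ n : mor (proj1_sig f ∘ n) (proj1_sig f' ∘ n)).
- by move=> f; rewrite hcomp_id.
- by move=> f f' f'' b a; apply: rwhisker_cmp.
Defined.

(** This and the next lemma give the naturality in [f] of the comparisons of [T(f) g h] and
    [T(f n) h] with [u Y ∘ f], used when an extension is restricted or a restriction extended. *)
Lemma unit_whisker_nat (W X Y : C) (g : hom W (T X)) (h : hom X W)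
  (k : mor (g ∘ h) (u X)) (f f' : hom X Y) (a : mor f f') :
  (tr_cell u f' • (map1 T f' ◁ k) • assoc (map1 T f') g h)
    • (map2 T a ▷ g ▷ h)
  = (u Y ◁ a) • tr_cell u f • (map1 T f ◁ k) • assoc (map1 T f) g h.
Proof.
rewrite !cmp_assoc -assoc_natl -(cmp_congr (interchange _ _)).
by rewrite -(cmp_congr (pn_nat u a)).
Qed.

Lemma unit_whisker_comp1_nat (V X Y : C) (h : hom X (T V)) (n : hom V X)
  (k : mor (map1 T n ∘ h) (u X)) (f f' : hom X Y) (a : mor f f') :
  ((tr_cell u f' • (map1 T f' ◁ k) • assoc (map1 T f') (map1 T n) h)
    • (bwd (pf_comp T f' n) ▷ h)) • (map2 T (a ▷ n) ▷ h)
  = (u Y ◁ a) • (tr_cell u f • (map1 T f ◁ k)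
    • assoc (map1 T f) (map1 T n) h) • (bwd (pf_comp T f n) ▷ h).
Proof.
have e : bwd (pf_comp T f' n) • map2 T (a ▷ n)
    = (map2 T a ▷ map1 T n) • bwd (pf_comp T f n).
  by rewrite -(bwd_nat (pf_comp_nat T a (idm n))) map2_id.
rewrite cmp_assoc -rwhisker_cmp e rwhisker_cmp -cmp_assoc unit_whisker_nat.
by rewrite !cmp_assoc.
Qed.

Section Object.
Context (X X' : C) (j : hom X' (T X)) (n : hom X X').
Context (jn : iso (j ∘ n) (u X)) (inv_j : is_inverter (mu X) j).
Context (Tmono : preserves_pseudomonic T).

Let mu_j : iso (u (T X) ∘ j) (map1 T (u X) ∘ j).
Proof.
by case: (constructive_indefinite_description _ inv_j) => h _; exact: is_iso_iso h.
Defined.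

Let Tjn : iso (map1 T j ∘ map1 T n) (map1 T (u X)) :=
  iso_cmp (map2_iso T jn) (pf_comp T j n).

(** [T(j) T(n) j ≅ T(u X) j ≅ u (T X) j ≅ T(j) u X'], the middle step inverting [mu X] along [j];
    then the pseudomonic [T(j)] is cancelled. *)
Lemma refl_unit_fact : inhabited (iso (map1 T n ∘ j) (u X')).
Proof.
apply: pseudomonic_reflect_iso (Tmono (inverter_pseudomonic inv_j)) _.
apply: iso_cmp (iso_inv (tr_cell u j)) _ => /=.
exact (iso_cmp (iso_inv mu_j)
  (iso_cmp (rwhisker_iso Tjn j) (iso_inv (assoc _ _ _)))).
Qed.

(** The candidate inverse of [T(n)]. It restricts along [u X'] to [j] by [beta], and [e T(n) ≅ 1] by
    [eta]. *)
Let e : hom (T X') (T X) := m X ∘ map1 T j.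

Let e_unit : iso (e ∘ u X') j :=
  iso_cmp (lunit j) (iso_cmp (rwhisker_iso (pm_beta T X) j)
  (iso_cmp (iso_inv (assoc (m X) (u (T X)) j))
  (iso_cmp (lwhisker_iso (m X) (tr_cell u j)) (assoc (m X) (map1 T j) (u X'))))).

Let e_retr : iso (e ∘ map1 T n) (id1 (T X)) :=
  iso_cmp (pm_eta T X) (iso_cmp (lwhisker_iso (m X) Tjn)
    (assoc (m X) (map1 T j) (map1 T n))).

(* [m_TX * T(mu_X)] is, up to isomorphism, the unit of an adjunction between
   [m_X] and [T(u_X)]; it becomes invertible after restriction along [T(j)]. *)
Let unit_mult : iso (map1 T (u X) ∘ (m X ∘ map1 T j)) (map1 T j).
Proof.
apply: iso_cmp (lunit _) _.
apply: iso_cmp (rwhisker_iso (pm_eta T (T X)) (map1 T j)) _ => /=.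
apply: iso_cmp (iso_inv (assoc _ _ _)) _.
apply: iso_cmp (lwhisker_iso _ (iso_inv (pf_comp T (u (T X)) j))) _.
(* The chain is built from its target backwards. Here the invertibility of [mu X] along [j] replaces
   [T(u X)] by [u (T X)] under [T]. *)
apply: iso_cmp (lwhisker_iso _ (map2_iso T (iso_inv mu_j))) _.
apply: iso_cmp (lwhisker_iso _ (pf_comp T (map1 T (u X)) j)) _.
apply: iso_cmp (assoc _ _ _) _.
exact (iso_cmp (rwhisker_iso (tr_cell m (u X)) (map1 T j))
  (iso_inv (assoc _ _ _))).
Defined.

(** [T(j) T(n) e ≅ T(u X) e ≅ T(j)], and [T(j)] can be cancelled. *)
Lemma refl_sect : inhabited (iso (map1 T n ∘ e) (id1 (T X'))).
Proof.
apply: pseudomonic_reflect_iso (Tmono (inverter_pseudomonic inv_j)) _.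
apply: iso_cmp (iso_inv (runit _)) _.
exact (iso_cmp unit_mult
  (iso_cmp (rwhisker_iso Tjn e) (iso_inv (assoc _ _ _)))).
Qed.

Lemma cone_Tn (W : C) (f : hom W (T X)) :
  is_inv_cone (mu X) f -> is_inv_cone (mu X') (map1 T n ∘ f).
Proof.
move=> h; apply/mu_nat_is_iso.
exact: (fun_is_iso (postcomp W (map1 T (map1 T n))) h).
Qed.

(** As [e] is not given as an image under [T], naturality of [mu] is applied to [n] instead:
    [f ≅ T(n) (e f)], so [TT(n) ◁ (mu X ▷ (e ∘ f))] is invertible, and [TT(n)] has the left inverse
    [T(e)]. *)
Lemma cone_e (W : C) (f : hom W (T X')) :
  is_inv_cone (mu X') f -> is_inv_cone (mu X) (e ∘ f).
Proof.
move=> h; have [i] := refl_sect.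
have TTn : iso (map1 T e ∘ map1 T (map1 T n)) (id1 (T (T X))).
  exact (iso_cmp (iso_inv (pf_unit T (T X)))
    (iso_cmp (map2_iso T e_retr) (pf_comp T e (map1 T n)))).
apply: (lwhisker_reflect_iso TTn); apply/mu_nat_is_iso.
apply/(is_iso_rwhisker_iso (mu X') (f' := f)) => //.
exact (iso_cmp (lunit f)
  (iso_cmp (rwhisker_iso i f) (iso_inv (assoc _ _ _)))).
Qed.

Lemma refl_is_inverter : is_inverter (mu X') (u X').
Proof.
exists (mu_cone_unit X') => W; case: inv_j => cone_j eJ.
have [i] := refl_sect.
(* Composition with [u X'], then [e], then [T(n)]: the first two compose to [j ∘ -], an equivalence
   since [j] is an inverter, and the last two to the identity. *)
apply: (@two_of_six _ _ _ _ _ (adjust_cone (@cone_e W))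
  (adjust_cone (@cone_Tn W)) (inv_cone_functor cone_j W)
  (functor_id (InvCone W (mu X')))).
- unshelve eexists.
    move=> h; apply: cone_iso.
    exact (iso_cmp (rwhisker_iso e_unit h) (iso_inv (assoc e (u X') h))).
  by move=> h h' a; apply: assoc_whisker_nat.
- unshelve eexists.
    move=> f; apply: cone_iso; apply: iso_cmp (lunit _) _.
    exact (iso_cmp (rwhisker_iso i _) (iso_inv (assoc (map1 T n) e _))).
  move=> f f' a.
  exact (assoc_whisker_unit_nat i a).
- exact: eJ.
- by exists (functor_id _); split; constructor; exact: nat_iso_id.
Qed.

Lemma cone_map1 (Y : C) (f : hom X Y) :
  is_inv_cone (mu Y) (map1 T f ∘ j).
Proof.
case: inv_j => cone_j _; apply/mu_nat_is_iso.
exact: (fun_is_iso (postcomp X' (map1 T (map1 T f))) cone_j).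
Qed.

Definition extend_cone (Y : C) : functor (hom X Y) (InvCone X' (mu Y)).
Proof.
exists (fun f => exist _ (map1 T f ∘ j) (cone_map1 f))
  (fun f f' a => map2 T a ▷ j : mor (map1 T f ∘ j) (map1 T f' ∘ j)).
- by move=> f; rewrite map2_id hcomp_id.
- by move=> f f' f'' b a; rewrite map2_cmp; apply: rwhisker_cmp.
Defined.

Lemma precomp_refl_unit (Y : C) :
  is_inverter (mu Y) (u Y) -> is_equivalence (precomp Y n).
Proof.
move=> [cone_Y eY]; have [d] := refl_unit_fact.
(* Restrict along [n], extend by [f ↦ T(f) j], restrict again. Both consecutive composites are
   [u Y ∘ -], as [T(g n) j ≅ T(g) u X' ≅ u Y g] and [T(f) j n ≅ T(f) u X ≅ u Y f]. *)
apply: (@two_of_six _ _ _ _ _ (extend_cone Y) (restrict_cone (mu Y) n)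
  (inv_cone_functor cone_Y X') (inv_cone_functor cone_Y X)) => //.
- unshelve eexists.
    move=> g; apply: cone_iso.
    exact (iso_cmp (iso_cmp (tr_cell u g)
      (iso_cmp (lwhisker_iso (map1 T g) d) (assoc (map1 T g) (map1 T n) j)))
      (rwhisker_iso (iso_inv (pf_comp T g n)) j)).
  move=> g g' a; exact (unit_whisker_comp1_nat d a).
- unshelve eexists.
    move=> f; apply: cone_iso.
    exact (iso_cmp (tr_cell u f)
      (iso_cmp (lwhisker_iso (map1 T f) jn) (assoc (map1 T f) j n))).
  move=> f f' a; exact (unit_whisker_nat jn a).
Qed.

End Object.

End Reflection.

(** * From pointwise reflections to the left biadjoint *)

Lemma reflective_left_biadjoint (C : bicategory) (P : C -> Prop) :
  (forall X : C, exists (X' : C) (n : hom X X'),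
    P X' /\ forall Z, P Z -> is_equivalence (precomp Z n)) ->
  has_left_biadjoint (inclusion P).
Proof.
move=> /(fun h X => constructive_indefinite_description _ (h X)) r.
pose r' X := constructive_indefinite_description _ (proj2_sig (r X)).
pose refl X := proj1_sig (r X); pose n X : hom X (refl X) := proj1_sig (r' X).
have reflP X : P (refl X) by case: (proj2_sig (r' X)).
have eqn X Z : P Z -> is_equivalence (precomp Z (n X)).
  by case: (proj2_sig (r' X)) => _; apply.
have ext (X Y Z : C) (q : hom Y Z) (f : hom X Y) : P Z -> square (n X) q f.
  move=> PZ; have := equivalence_surj (eqn X Z PZ) (q ∘ f).
  move=> /constructive_indefinite_description[h] H.
  (* [inhabited] is recast as an existential so that choice yields an actual isomorphism. *)
  have /constructive_indefinite_description[i _] :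
      exists i : iso (h ∘ n X) (q ∘ f), True by case: H => i; exists i.
  exact: Square i.
have liftP (X Y Z : C) (q : hom Y Z) (f f' : hom X Y) (S : square (n X) q f)
    (S' : square (n X) q f') (PZ : P Z) (a : mor f f') :
    exists b : mor S S', over S S' a b.
  (* Being over [a] prescribes [b ▷ n X], namely as [a] conjugated by the two cells; fullness
     provides such a [b]. *)
  have [b eb] := equivalence_full (eqn X Z PZ)
    (bwd (sq_cell S') • (q ◁ a) • sq_cell S).
  by exists b; rewrite /over [_ ▷ _]eb fwdK.
have over_inj (X Y Z : C) (q : hom Y Z) (f f' : hom X Y)
    (S : square (n X) q f) (S' : square (n X) q f') (a : mor f f')
    (b b' : mor S S') : P Z -> over S S' a b -> over S S' a b' -> b = b'.
  rewrite /over => PZ h h'; apply: (equivalence_faithful (eqn X Z PZ)).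
  by apply: (iso_monic (a := sq_cell S')); rewrite /= h h'.
pose lift X Y Z q f f' S S' PZ a := constructive_indefinite_description _
  (@liftP X Y Z q f f' S S' PZ a).
pose lift_over X Y Z q f f' S S' PZ a := proj2_sig (@lift X Y Z q f f' S S' PZ a).
constructor.
exact (LeftBiadjoint (reflector_left reflP ext lift_over over_inj)
  (reflector_right reflP ext lift_over over_inj)).
Qed.

Theorem proposition6 (C : bicategory) (T : KZ_monad C)
  (hinv : has_inverters C) (hT : preserves_pseudomonic T) :
  has_left_biadjoint
    (inclusion (fun X : C => is_inverter (kz_mu T X) (pm_unit T X))).
Proof.
apply: reflective_left_biadjoint => X.
have [X' [j inv_j]] := hinv _ _ _ _ (kz_mu T X).
have [n [jn]] := inverter_factor inv_j (mu_cone_unit T X).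
exists X', n; split; first exact: refl_is_inverter jn inv_j hT.
by move=> Y eY; exact (precomp_refl_unit jn inv_j hT eY).
Qed.
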